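(* Let $p\ge 1$ and let $e_1,\dots,e_p$ be pairwise distinct real numbers. Consider on $\boldsymbol{S}=(S^2)^p$ the closed-loop system $$\dot x_{e_i}=-e_i y_{e_i}+u_2 z_{e_i},\qquad \dot y_{e_i}=e_i x_{e_i}+u_1 z_{e_i},\qquad \dot z_{e_i}=-u_2x_{e_i}-u_1y_{e_i},\qquad i=1,\dots,p,$$ with the feedback control $$u_1=\sum_{j=1}^p y_{e_j},\qquad u_2=\sum_{j=1}^p x_{e_j}.$$ Then the point $\boldsymbol{X}^-\in \boldsymbol{S}$, all of whose components equal $(0,0,-1)$, is asymptotically stable for this system, and its basin of attraction is open and dense in $\boldsymbol{S}$.
   Context: $S^2\subset\mathbb{R}^3$ is the unit sphere, and $\boldsymbol{S}=(S^2)^p$ carries the product topology; a point is written $\boldsymbol{X}=(X_{e_1},\dots,X_{e_p})$ with $X_{e_i}=(x_{e_i},y_{e_i},z_{e_i})\in S^2$. The closed-loop system is an autonomous ODE leaving $\boldsymbol{S}$ invariant; $\phi^t$ denotes its flow on $\boldsymbol{S}$. Asymptotic stability is understood for the system on $\boldsymbol{S}$. The basin of attraction of $\boldsymbol{X}^-$ is the set of $\boldsymbol{X}_0\in\boldsymbol{S}$ such that $\phi^t(\boldsymbol{X}_0)\to\boldsymbol{X}^-$ as $t\to+\infty$. *)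

(* Defs.v *)
From HB Require Import structures.
From mathcomp Require Import all_boot all_order all_algebra.
From mathcomp Require Import all_classical all_reals all_analysis.

Set Implicit Arguments.
Unset Strict Implicit.
Unset Printing Implicit Defensive.

Import Order.TTheory GRing.Theory Num.Theory numFieldNormedType.Exports.

Local Open Scope classical_set_scope.
Local Open Scope ring_scope.

(* A family of p vectors of R^3 is a p x 3 matrix: row i is (x_i, y_i, z_i).
   The library topology on matrices is the product topology of the entries,
   so the subspace topology of (S^2)^p is the product topology. *)
Definition xc (R : realType) (p : nat) (X : 'M[R]_(p, 3)) (i : 'I_p) : R := X i 0.
Definition yc (R : realType) (p : nat) (X : 'M[R]_(p, 3)) (i : 'I_p) : R := X i 1.
Definition zc (R : realType) (p : nat) (X : 'M[R]_(p, 3)) (i : 'I_p) : R := X i 2.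

Definition spheres (R : realType) (p : nat) : set 'M[R]_(p, 3) :=
  [set X | forall i, xc X i ^+ 2 + yc X i ^+ 2 + zc X i ^+ 2 = 1].

Definition bloch_field (R : realType) (p : nat) (e : 'I_p -> R) (u1 u2 : R)
    (X : 'M[R]_(p, 3)) : 'M[R]_(p, 3) :=
  \matrix_(i < p, k < 3)
    [:: - e i * yc X i + u2 * zc X i;
          e i * xc X i + u1 * zc X i;
        - u2 * xc X i - u1 * yc X i ]`_k.

Definition feedback1 (R : realType) (p : nat) (X : 'M[R]_(p, 3)) : R :=
  \sum_(j < p) yc X j.
Definition feedback2 (R : realType) (p : nat) (X : 'M[R]_(p, 3)) : R :=
  \sum_(j < p) xc X j.

Definition closed_loop (R : realType) (p : nat) (e : 'I_p -> R)
    (X : 'M[R]_(p, 3)) : 'M[R]_(p, 3) :=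
  bloch_field e (feedback1 X) (feedback2 X) X.

Definition south (R : realType) (p : nat) : 'M[R]_(p, 3) :=
  \matrix_(i < p, k < 3) [:: 0; 0; -1]`_k.

(* phi t X is the value at time t of the solution of X' = F X issued from X;
   nothing is required of phi outside S. The group property and the
   continuity in X are not imposed: for locally Lipschitz F they follow. *)
Definition is_flow_on (R : realType) (m n : nat) (S : set 'M[R]_(m, n))
    (F : 'M[R]_(m, n) -> 'M[R]_(m, n)) (phi : R -> 'M[R]_(m, n) -> 'M[R]_(m, n)) : Prop :=
  forall X, S X ->
    [/\ phi 0 X = X,
        forall t, S (phi t X) &
        forall (t : R) i k,
          is_derive t (1 : R) (fun s : R => phi s X i k) (F (phi t X) i k)].

Definition basin (R : realType) (T : topologicalType) (S : set T)
    (phi : R -> T -> T) (x : T) : set T :=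
  [set y | S y /\ phi t y @[t --> +oo%R] --> x].

Definition lyapunov_stable (R : realType) (T : topologicalType) (S : set T)
    (phi : R -> T -> T) (x : T) : Prop :=
  forall U, nbhs x U ->
    \forall y \near within S (nbhs x), forall t, 0 <= t -> U (phi t y).

Definition locally_attractive (R : realType) (T : topologicalType) (S : set T)
    (phi : R -> T -> T) (x : T) : Prop :=
  \forall y \near within S (nbhs x), basin S phi x y.

Definition asymptotically_stable (R : realType) (T : topologicalType)
    (S : set T) (phi : R -> T -> T) (x : T) : Prop :=
  lyapunov_stable S phi x /\ locally_attractive S phi x.

(* Main.v *)
Require Import Defs.
From HB Require Import structures.
From mathcomp Require Import all_boot all_order all_algebra.
From mathcomp Require Import all_classical all_reals all_analysis.
From mathcomp Require Import ring lra.
Import Order.TTheory GRing.Theory Num.Theory numFieldNormedType.Exports.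
Local Open Scope classical_set_scope.
Local Open Scope ring_scope.

Set Implicit Arguments.
Unset Strict Implicit.
Unset Printing Implicit Defensive.

(* Write N = sum_i (x_i^2 + y_i^2), L = sum_i z_i, so L' = -(u_1^2 + u_2^2).
   Along pure rotations, R = sum_{i,j} 2 / (e_i - e_j) x_i y_j satisfies
   R' = N - u_1^2 - u_2^2 exactly. Hence for C large C L - R is a strict
   Lyapunov function (derivative at most -N/2), every trajectory settles at
   some point with z_i = s_i = +-1, and the basin of the south point is
   { X | L(phi^t X) < 2 - p for some t }, which is open.
   For density, let a trajectory settle at s with some s_j = +1. Perturb its
   j-th vector at a late time. If the perturbed trajectory did not settle at a
   strictly lower level of L, it would dissipate almost nothing, hence stay near
   s for ever. But the difference (dx, dy) of two trajectories near s makes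
   M sum_i s_i (dx_i^2 + dy_i^2) + R(dx, dy) grow exponentially, and this form is
   positive for the chosen perturbation: a contradiction. The level of L takes
   finitely many values, so finitely many perturbations reach the basin. *)

(** * Calculus on the real line *)

Section Calculus.
Context {R : realType}.
Implicit Types (f g : R -> R) (t s c K : R).

Lemma is_derive_addf f g t (df dg : R) :
  is_derive t (1 : R) f df -> is_derive t (1 : R) g dg ->
  is_derive t (1 : R) (fun u => f u + g u) (df + dg).
Proof. exact: is_deriveD. Qed.

Lemma is_derive_subf f g t (df dg : R) :
  is_derive t (1 : R) f df -> is_derive t (1 : R) g dg ->
  is_derive t (1 : R) (fun u => f u - g u) (df - dg).
Proof. exact: is_deriveB. Qed.

Lemma is_derive_mulf f g t (df dg : R) :
  is_derive t (1 : R) f df -> is_derive t (1 : R) g dg ->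
  is_derive t (1 : R) (fun u => f u * g u) (df * g t + f t * dg).
Proof.
move=> hf hg; apply: (is_derive_eq (is_deriveM hf hg)).
by rewrite /GRing.scale /=; ring.
Qed.

Lemma is_derive_mulcf c f t (df : R) :
  is_derive t (1 : R) f df -> is_derive t (1 : R) (fun u => c * f u) (c * df).
Proof. by move=> hf; exact: (is_deriveZ c hf). Qed.

Lemma is_derive_sqrf f t (df : R) :
  is_derive t (1 : R) f df -> is_derive t (1 : R) (fun u => f u ^+ 2) (2 * f t * df).
Proof.
move=> hf; apply: (is_derive_eq (is_derive_mulf hf hf)).
by ring.
Qed.

Lemma is_derive_sumf n (f : 'I_n -> R -> R) t (df : 'I_n -> R) :
  (forall i, is_derive t (1 : R) (f i) (df i)) ->
  is_derive t (1 : R) (fun u => \sum_(i < n) f i u) (\sum_(i < n) df i).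
Proof.
move=> hf; have -> : (fun u => \sum_(i < n) f i u) = \sum_(i < n) f i.
  by apply/funext => u; rewrite fct_sumE.
exact: is_derive_sum.
Qed.

Lemma is_derive_translate f c t (df : R) :
  is_derive (t + c) 1 f df -> is_derive t (1 : R) (fun u => f (u + c)) df.
Proof.
move=> hf.
have hg : is_derive t (1 : R) (fun u : R => u + c) 1.
  by apply: (is_derive_eq (is_deriveD (is_derive_id t 1) (is_derive_cst c t 1))); rewrite addr0.
by apply: (is_derive_eq (@is_derive1_comp R f (fun u => u + c) t df 1 hf hg)); rewrite mulr1.
Qed.

Lemma mean_value f (df : R -> R) s t :
  (forall u, is_derive u (1 : R) f (df u)) -> s <= t ->
  exists2 c, s <= c <= t & f t - f s = df c * (t - s).
Proof.
move=> hf st; have cf : {within `[s, t], continuous f}.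
  apply: continuous_subspaceT => u.
  by apply/differentiable_continuous/derivable1_diffP; have [] := hf u.
have [c] := MVT_segment st (fun u _ => hf u) cf.
by rewrite in_itv /=; exists c.
Qed.

(** The product [f u * expR (- K * u)] has a nonnegative derivative on the interval. A negated
    function yields an upper bound, a negative [K] a bound backwards in time. *)
Lemma gronwall_ge f (df : R -> R) K s t :
  (forall u, is_derive u (1 : R) f (df u)) -> s <= t ->
  (forall u, s <= u <= t -> K * f u <= df u) ->
  f s * expR (K * (t - s)) <= f t.
Proof.
move=> hf st hK.
pose g u := f u * expR (- K * u).
have hg u : is_derive u (1 : R) g ((df u - K * f u) * expR (- K * u)).
  have h1 : is_derive u (1 : R) (fun v => expR (- K * v)) (expR (- K * u) * - K).
    apply: (@is_derive1_comp R expR (fun v => - K * v) u).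
    have := @is_derive_mulcf (- K) id u 1 (is_derive_id u 1).
    by rewrite mulr1.
  apply: (is_derive_eq (is_derive_mulf (hf u) h1)).
  by ring.
have [c cst hc] := mean_value hg st.
have : 0 <= g t - g s.
  rewrite hc mulr_ge0 ?subr_ge0 // mulr_ge0 ?expR_ge0 // subr_ge0.
  exact: hK.
rewrite subr_ge0 /g => hgst.
have -> : K * (t - s) = - K * s + K * t by ring.
have -> : f t = f t * expR (- K * t) * expR (K * t).
  by rewrite -mulrA -expRD mulNr addNr expR0 mulr1.
by rewrite expRD mulrA ler_pM2r ?expR_gt0.
Qed.

Lemma nonincreasing_of_derive f (df : R -> R) s t :
  (forall u, is_derive u (1 : R) f (df u)) -> (forall u, df u <= 0) ->
  s <= t -> f t <= f s.
Proof.
move=> hf hdf st; have [c _ hc] := mean_value hf st.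
by rewrite -subr_le0 hc mulr_le0_ge0 ?subr_ge0.
Qed.

(* A quantitative form of Barbalat's lemma. *)
Lemma dissipation_small f g (df dg : R -> R) K t tau eta :
  (forall u, is_derive u (1 : R) f (df u)) -> (forall u, df u <= - g u) ->
  (forall u, is_derive u (1 : R) g (dg u)) -> (forall u, - K <= dg u) ->
  0 < tau -> 0 <= K -> f t - f (t + tau) <= eta * tau ->
  g t <= eta + K * tau.
Proof.
move=> hf fg hg gK tau0 K0 loss.
have ttau : t <= t + tau by rewrite lerDl ltW.
(* The loss over the window forces [g c <= eta] at some [c]; from [t] to [c], [g] drops by at most
   [K * tau]. *)
have [c /andP[tc ct] hc] := mean_value hf ttau.
have [d _ hd] := mean_value hg tc.
have h1 : g c * tau <= eta * tau.
  rewrite (le_trans _ loss) // -opprB hc.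
  have -> : t + tau - t = tau by ring.
  by rewrite -mulNr ler_pM2r // lerNr fg.
rewrite ler_pM2r // in h1.
have h2 : - K * (c - t) <= g c - g t.
  by rewrite hd ler_wpM2r ?subr_ge0.
have h3 : K * (c - t) <= K * tau by rewrite ler_wpM2l //; lra.
lra.
Qed.

(** Past [T] the function is within [eta] of its infimum, so every later window loses at most
    [eta]. *)
Lemma nonincreasing_settles f m eta :
  (forall s t, s <= t -> f t <= f s) -> (forall t, m <= f t) -> 0 < eta ->
  exists T, forall s t, T <= s -> f s - f t <= eta.
Proof.
move=> hf hm eta0.
have hi : has_inf (range f).
  by split; [exists (f 0); exists 0|exists m => _ [t _ <-]].
have [_ [T _ <-] hT] := inf_adherent eta0 hi.
exists T => s t Ts.
have h1 : inf (range f) <= f t.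
  by apply: ge_inf; [exact: hi.2|exists t].
have := hf _ _ Ts; lra.
Qed.

Lemma const_sign f (df : R -> R) s t :
  (forall u, is_derive u (1 : R) f (df u)) -> s <= t ->
  (forall u, s <= u <= t -> f u != 0) -> 0 < f s -> 0 < f t.
Proof.
move=> hf st hn fs; rewrite ltNge; apply/negP => ft.
have cf : {within `[s, t], continuous f}.
  apply: continuous_subspaceT => u.
  by apply/differentiable_continuous/derivable1_diffP; have [] := hf u.
have [|c] := IVT st cf (v := 0).
  by rewrite ge_min le_max ft (ltW fs) orbT.
by rewrite in_itv /= => /hn /eqP.
Qed.

End Calculus.

(** * The observing quadratic form *)

Section Observer.
Context {R : realType} {p : nat} (e : 'I_p -> R).
Hypothesis e_inj : injective e.
Implicit Types (x y g h : 'I_p -> R).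

Definition energy x y : R := \sum_i (x i ^+ 2 + y i ^+ 2).

(* The diagonal coefficients vanish, since 0^-1 = 0. *)
Definition obs_coef (i j : 'I_p) : R := 2 * (e i - e j)^-1.

Definition obs x y : R := \sum_i \sum_j obs_coef i j * (x i * y j).

Definition obs_norm : R := \sum_i \sum_j `|obs_coef i j|.

(** The price of the forcing terms in [obs_dissipation]: twice [obs_norm], times the weight
    [obs_norm + 1] given there to Young's inequality. *)
Definition obs_gain : R := 2 * obs_norm * (obs_norm + 1).

Lemma obs_norm_ge0 : 0 <= obs_norm.
Proof. by apply: sumr_ge0 => i _; apply: sumr_ge0. Qed.

Lemma obs_gain_ge0 : 0 <= obs_gain.
Proof. by have := obs_norm_ge0; rewrite /obs_gain; nra. Qed.

Lemma energy_ge0 x y : 0 <= energy x y.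
Proof. by apply: sumr_ge0 => i _; rewrite addr_ge0 ?sqr_ge0. Qed.

Lemma energy_ge x y i : x i ^+ 2 + y i ^+ 2 <= energy x y.
Proof.
rewrite /energy (bigD1 i) //= lerDl.
by apply: sumr_ge0 => j _; rewrite addr_ge0 ?sqr_ge0.
Qed.

Lemma energy_gel x y i : x i ^+ 2 <= energy x y.
Proof. by apply: le_trans (energy_ge x y i); rewrite lerDl sqr_ge0. Qed.

Lemma energy_ger x y i : y i ^+ 2 <= energy x y.
Proof. by apply: le_trans (energy_ge x y i); rewrite lerDr sqr_ge0. Qed.

Lemma obs_coefN i j : obs_coef j i = - obs_coef i j.
Proof. by rewrite /obs_coef -(opprB (e i)) invrN mulrN. Qed.

Lemma obs_coefE i j : obs_coef i j * (e i - e j) = 2 * (i != j)%:R.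
Proof.
have [->|ij] := eqVneq i j; first by rewrite subrr !mulr0.
rewrite /obs_coef mulfVK ?mulr1 // subr_eq0.
by apply: contra ij => /eqP /e_inj ->.
Qed.

Lemma sqr_sum x : (\sum_i x i) ^+ 2 = \sum_i \sum_j x i * x j.
Proof. by rewrite expr2 big_distrlr. Qed.

(** Symmetrising in [i, j] makes the coefficient [obs_coef i j * (e j - e i)], which is -2 off the
    diagonal and 0 on it; the missing diagonal of the squared sum is the sum of squares. *)
Lemma obs_coef_quad x :
  \sum_i \sum_j obs_coef i j * (x i * (e j * x j)) =
  \sum_i x i ^+ 2 - (\sum_i x i) ^+ 2.
Proof.
set S := LHS.
have S2 : S = \sum_i \sum_j obs_coef j i * (x j * (e i * x i)) by rewrite /S exchange_big.
have : S + S = \sum_i (2 * x i ^+ 2 - 2 * \sum_j x i * x j).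
  rewrite {2}S2 -big_split; apply: eq_bigr => i _ /=.
  have -> : 2 * x i ^+ 2 = \sum_j 2 * ((i == j)%:R * (x i * x j)).
    rewrite -mulr_sumr (bigD1 i) //= eqxx big1 => [|j ji]; first by rewrite mul1r addr0 expr2.
    by rewrite eq_sym (negbTE ji) mul0r.
  rewrite mulr_sumr -sumrB -big_split; apply: eq_bigr => j _ /=.
  rewrite (obs_coefN i j).
  have -> : obs_coef i j * (x i * (e j * x j)) + - obs_coef i j * (x j * (e i * x i)) =
            - (obs_coef i j * (e i - e j)) * (x i * x j) by ring.
  rewrite obs_coefE; case: (i == j) => /=; ring.
rewrite sumrB -!mulr_sumr -sqr_sum => h.
by lra.
Qed.

(** Exchanging the indices and using antisymmetry of [obs_coef] brings the [y] part to the form of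
    the [x] part; [obs_coef_quad] then applies to both. *)
Lemma obs_rotation x y :
  \sum_i \sum_j obs_coef i j * ((- e i * y i) * y j + x i * (e j * x j)) =
  energy x y - (\sum_i x i) ^+ 2 - (\sum_i y i) ^+ 2.
Proof.
have -> : energy x y = \sum_i x i ^+ 2 + \sum_i y i ^+ 2 by rewrite -big_split.
transitivity (\sum_i \sum_j obs_coef i j * (y i * (e j * y j)) +
              \sum_i \sum_j obs_coef i j * (x i * (e j * x j))).
  rewrite [X in _ = X + _]exchange_big /= -big_split; apply: eq_bigr => i _ /=.
  rewrite -big_split; apply: eq_bigr => j _ /=.
  by rewrite (obs_coefN i j); ring.
by rewrite !obs_coef_quad; ring.
Qed.

(** Young's inequality with weight [l], from the square of [2 * l * |u| - |v|]. *)
Lemma obs_term_ge (c u v m N l : R) : 0 < l -> u ^+ 2 <= m -> v ^+ 2 <= N ->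
  - (`|c| * (l * m + N / (4 * l))) <= c * (u * v).
Proof.
move=> l0 um vN.
have h : `|u * v| <= l * m + N / (4 * l).
  have -> : l * m + N / (4 * l) = (4 * l ^+ 2 * m + N) / (4 * l).
    by field; rewrite gt_eqF.
  rewrite ler_pdivlMr ?mulr_gt0 // normrM.
  rewrite -(real_normK (num_real u)) in um.
  rewrite -(real_normK (num_real v)) in vN.
  have : 0 <= (2 * l * `|u| - `|v|) ^+ 2 by exact: sqr_ge0.
  have : l ^+ 2 * `|u| ^+ 2 <= l ^+ 2 * m by rewrite ler_wpM2l ?sqr_ge0.
  by lra.
have : `|c * (u * v)| <= `|c| * (l * m + N / (4 * l)).
  by rewrite normrM ler_wpM2l.
by rewrite ler_norml => /andP[].
Qed.

(** Stated for arbitrary forcing [g], [h], so as to serve both one trajectory and the difference of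
    two. The rotation part yields the full energy; since [obs_norm / l <= 1], Young's inequality
    spends at most half of it on the forcing. *)
Lemma obs_dissipation x y g h m :
  (forall i, g i ^+ 2 <= m) -> (forall i, h i ^+ 2 <= m) ->
  energy x y / 2 - ((\sum_i x i) ^+ 2 + (\sum_i y i) ^+ 2) - obs_gain * m <=
  \sum_i \sum_j obs_coef i j *
    ((- e i * y i + g i) * y j + x i * (e j * x j + h j)).
Proof.
move=> gm hm; set N := energy x y.
set l := obs_norm + 1.
have k0 := obs_norm_ge0; have l0 : 0 < l by rewrite /l; lra.
set b := l * m + N / (4 * l).
have -> : \sum_i \sum_j obs_coef i j *
    ((- e i * y i + g i) * y j + x i * (e j * x j + h j)) =
  \sum_i \sum_j obs_coef i j * ((- e i * y i) * y j + x i * (e j * x j)) +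
  \sum_i \sum_j (obs_coef i j * (g i * y j) + obs_coef i j * (h j * x i)).
  rewrite -big_split; apply: eq_bigr => i _ /=.
  by rewrite -big_split; apply: eq_bigr => j _ /=; ring.
rewrite obs_rotation -/N.
have h1 : - (2 * obs_norm * b) <=
    \sum_i \sum_j (obs_coef i j * (g i * y j) + obs_coef i j * (h j * x i)).
  rewrite /obs_norm mulr_sumr mulr_suml -sumrN; apply: ler_sum => i _.
  rewrite mulr_sumr mulr_suml -sumrN; apply: ler_sum => j _.
  have h2 := obs_term_ge (obs_coef i j) l0 (gm i) (energy_ger x y j).
  have h3 := obs_term_ge (obs_coef i j) l0 (hm j) (energy_gel x y i).
  by move: h2 h3; rewrite -/N -/b; lra.
have h4 : 2 * obs_norm * b <= obs_gain * m + N / 2.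
  rewrite /b /obs_gain -/l mulrDr mulrA lerD2l.
  have -> : 2 * obs_norm * (N / (4 * l)) = (N / 2) * (obs_norm / l).
    by field; rewrite gt_eqF.
  rewrite ler_piMr ?divr_ge0 ?energy_ge0 // ler_pdivrMr // mul1r /l.
  by lra.
by lra.
Qed.

Lemma obs_le x y : `|obs x y| <= obs_norm * energy x y.
Proof.
rewrite /obs /obs_norm mulr_suml (le_trans (ler_norm_sum _ _ _)) //.
apply: ler_sum => i _; rewrite mulr_suml (le_trans (ler_norm_sum _ _ _)) //.
apply: ler_sum => j _; rewrite normrM ler_wpM2l // ler_norml.
have := energy_gel x y i; have := energy_ger x y j.
by nra.
Qed.

Lemma is_derive_obs (x y : R -> 'I_p -> R) (dx dy : 'I_p -> R) (t : R) :
  (forall i, is_derive t (1 : R) (fun u => x u i) (dx i)) ->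
  (forall i, is_derive t (1 : R) (fun u => y u i) (dy i)) ->
  is_derive t (1 : R) (fun u => obs (x u) (y u))
    (\sum_i \sum_j obs_coef i j * (dx i * y t j + x t i * dy j)).
Proof.
move=> hx hy; apply: is_derive_sumf => i; apply: is_derive_sumf => j.
apply: is_derive_mulcf.
exact: (is_derive_mulf (f := fun u => x u i) (g := fun u => y u j)).
Qed.

End Observer.

(** * Dissipation along the closed loop *)

Section Dissipation.
Context {R : realType} {p : nat} (e : 'I_p -> R).
Hypothesis e_inj : injective e.
Implicit Types (X : 'M[R]_(p, 3)) (a : R -> 'M[R]_(p, 3)).

(** Solutions live on the whole time line: a perturbation made at a late time is followed back to
    time 0. *)
Definition solution a : Prop :=
  (forall t, spheres (a t)) /\
  forall t i k, is_derive t (1 : R) (fun u => a u i k) (closed_loop e (a t) i k).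

Definition height X : R := \sum_i zc X i.

Definition tilt X : R := energy (xc X) (yc X).

Definition lyap X : R := (1 + obs_gain e) * height X - obs e (xc X) (yc X).

(** A configuration of poles is a boolean family in which [true] stands for the south pole. *)
Definition pole_height (s : 'I_p -> bool) : R := \sum_i (-1) ^+ s i.

Lemma solution_x a t i : solution a ->
  is_derive t (1 : R) (fun u => xc (a u) i)
    (- e i * yc (a t) i + feedback2 (a t) * zc (a t) i).
Proof. by move=> [_ /(_ t i 0)]; rewrite mxE. Qed.

Lemma solution_y a t i : solution a ->
  is_derive t (1 : R) (fun u => yc (a u) i)
    (e i * xc (a t) i + feedback1 (a t) * zc (a t) i).
Proof. by move=> [_ /(_ t i 1)]; rewrite mxE. Qed.

Lemma solution_z a t i : solution a ->
  is_derive t (1 : R) (fun u => zc (a u) i)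
    (- feedback2 (a t) * xc (a t) i - feedback1 (a t) * yc (a t) i).
Proof. by move=> [_ /(_ t i 2)]; rewrite mxE. Qed.

Lemma solution_shift a c : solution a -> solution (fun t => a (t + c)).
Proof.
move=> [aS aD]; split=> [t|t i k]; first exact: aS.
exact: (is_derive_translate (f := fun u => a u i k) (aD (t + c) i k)).
Qed.

Lemma solution_height a t : solution a ->
  is_derive t (1 : R) (fun u => height (a u))
    (- (feedback2 (a t) ^+ 2 + feedback1 (a t) ^+ 2)).
Proof.
move=> sa; apply: is_derive_eq (is_derive_sumf (fun i => solution_z t i sa)) _.
by rewrite sumrB -!mulr_sumr -/(feedback1 _) -/(feedback2 _); ring.
Qed.

Lemma height_nonincreasing a s t : solution a -> s <= t ->
  height (a t) <= height (a s).
Proof.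
move=> sa; have hd u := solution_height u sa.
apply: (nonincreasing_of_derive hd) => u.
by rewrite oppr_le0 addr_ge0 ?sqr_ge0.
Qed.

Lemma sphere_norm X i : spheres X ->
  [/\ `|xc X i| <= 1, `|yc X i| <= 1 & `|zc X i| <= 1].
Proof. by move=> /(_ i) h; split; rewrite ler_norml; nra. Qed.

Lemma sphere_tilt_le X : spheres X -> tilt X <= p%:R.
Proof.
move=> SX; have -> : p%:R = \sum_(i < p) (1 : R) by rewrite sumr_const card_ord.
by apply: ler_sum => i _; have := SX i; nra.
Qed.

Lemma norm_sum_le (f : 'I_p -> R) c : (forall i, `|f i| <= c) ->
  `|\sum_i f i| <= p%:R * c.
Proof.
move=> fc; rewrite (le_trans (ler_norm_sum _ _ _)) //.
have -> : p%:R * c = \sum_(i < p) c by rewrite sumr_const card_ord mulr_natl.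
exact: ler_sum.
Qed.

(** The factor [1 + obs_gain e] cancels the control terms exactly: 1 for the squared controls left
    by the rotation part, [obs_gain e] for the forcing, whose squares are at most [m] because
    [z_i ^+ 2 <= 1]. *)
Lemma solution_lyap a t : solution a ->
  exists2 d, is_derive t (1 : R) (fun u => lyap (a u)) d & d <= - (tilt (a t) / 2).
Proof.
move=> sa; set X := a t.
have dz := is_derive_mulcf (1 + obs_gain e) (solution_height t sa).
have dR := is_derive_obs e (fun i => solution_x t i sa) (fun i => solution_y t i sa).
eexists; first exact: (is_derive_subf dz dR).
have z1 i : zc X i ^+ 2 <= 1 by have [_ _] := sphere_norm i (sa.1 t); rewrite ler_norml -/X; nra.
set m := feedback2 X ^+ 2 + feedback1 X ^+ 2.
have b2 := sqr_ge0 (feedback2 X); have b1 := sqr_ge0 (feedback1 X).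
have g1 i : (feedback2 X * zc X i) ^+ 2 <= m.
  by rewrite exprMn /m; have := z1 i; nra.
have g2 i : (feedback1 X * zc X i) ^+ 2 <= m.
  by rewrite exprMn /m; have := z1 i; nra.
have := obs_dissipation e_inj (xc X) (yc X) g1 g2; rewrite -/X.
rewrite -/(feedback1 X) -/(feedback2 X) -/m /tilt.
by lra.
Qed.

(** Choice turns the pointwise derivatives into a function of time, as the calculus lemmas
    expect. *)
Lemma solution_lyap_fun a : solution a ->
  exists2 d : R -> R, forall t, is_derive t (1 : R) (fun u => lyap (a u)) (d t) &
    forall t, d t <= - (tilt (a t) / 2).
Proof.
move=> sa; exists (fun t => projT1 (cid2 (solution_lyap t sa))) => t;
  by case: (cid2 (solution_lyap t sa)).
Qed.

Lemma lyap_nonincreasing a s t : solution a -> s <= t -> lyap (a t) <= lyap (a s).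
Proof.
move=> sa; have [d ad dn] := solution_lyap_fun sa.
apply: (nonincreasing_of_derive ad) => u; apply: le_trans (dn u) _.
by rewrite oppr_le0 divr_ge0 ?energy_ge0.
Qed.

Lemma lyap_ge X : spheres X ->
  - ((1 + obs_gain e) * p%:R + obs_norm e * p%:R) <= lyap X.
Proof.
move=> SX; have k0 := obs_norm_ge0 e; have g0 := obs_gain_ge0 e.
have : `|height X| <= p%:R * 1.
  by apply: norm_sum_le => i; have [] := sphere_norm i SX.
have := obs_le e (xc X) (yc X).
have : obs_norm e * energy (xc X) (yc X) <= obs_norm e * p%:R.
  by rewrite ler_wpM2l //; exact: sphere_tilt_le.
rewrite /lyap mulr1 => h1 h2; rewrite ler_norml => /andP[h3 _].
have : `|obs e (xc X) (yc X)| <= obs_norm e * p%:R by exact: le_trans h2 h1.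
rewrite ler_norml => /andP[_ h4].
have : - ((1 + obs_gain e) * p%:R) <= (1 + obs_gain e) * height X.
  by rewrite -mulrN ler_wpM2l //; lra.
by lra.
Qed.

Lemma tilt_small a t tau eta : solution a -> 0 < tau ->
  lyap (a t) - lyap (a (t + tau)) <= eta * tau ->
  tilt (a t) / 2 <= eta + 2 * p%:R ^+ 2 * tau.
Proof.
move=> sa tau0 loss; have [d ad dn] := solution_lyap_fun sa.
pose dg u : R := \sum_i zc (a u) i *
  (feedback2 (a u) * xc (a u) i + feedback1 (a u) * yc (a u) i).
apply: (@dissipation_small _ (fun u => lyap (a u)) (fun u => tilt (a u) / 2) d dg) => //.
- move=> u; have hs : is_derive u (1 : R) (fun v => 2^-1 * tilt (a v)) (2^-1 * (2 * dg u)).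
    apply: is_derive_mulcf; rewrite /tilt /energy.
    apply: is_derive_eq (is_derive_sumf (fun i => is_derive_addf
      (is_derive_sqrf (solution_x u i sa)) (is_derive_sqrf (solution_y u i sa)))) _.
    by rewrite /dg mulr_sumr; apply: eq_bigr => i _; ring.
  have -> : (fun v => tilt (a v) / 2) = (fun v => 2^-1 * tilt (a v)).
    by apply/funext => v; rewrite mulrC.
  by apply: is_derive_eq hs _; field.
- move=> u; have [aS _] := sa.
  have h1 : `|feedback1 (a u)| <= p%:R * 1.
    by apply: norm_sum_le => i; have [] := sphere_norm i (aS u).
  have h2 : `|feedback2 (a u)| <= p%:R * 1.
    by apply: norm_sum_le => i; have [] := sphere_norm i (aS u).
  have : `|dg u| <= p%:R * (2 * p%:R).
    apply: norm_sum_le => i; have [hx hy hz] := sphere_norm i (aS u).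
    rewrite normrM -[leRHS]mul1r ler_pM // (le_trans (ler_normD _ _)) // !normrM.
    rewrite mulr1 in h1 h2.
    have := ler_pM (normr_ge0 _) (normr_ge0 _) h1 hy.
    have := ler_pM (normr_ge0 _) (normr_ge0 _) h2 hx.
    by lra.
  by rewrite ler_norml => /andP[h _]; move: h; lra.
Qed.

(** The constants are uniform over all solutions, so they can be fixed before a perturbed solution
    is chosen. *)
Lemma tilt_small_of_loss (mu : R) : 0 < mu ->
  exists tau eta, [/\ 0 < tau, 0 < eta & forall a t, solution a ->
    lyap (a t) - lyap (a (t + tau)) <= eta -> tilt (a t) <= mu].
Proof.
move=> mu0; set K : R := 2 * p%:R ^+ 2.
have K0 : 0 <= K by rewrite mulr_ge0 ?sqr_ge0.
(* Half of the tilt is to be at most [mu / 2]: one quarter of [mu] is allotted to [K * tau], the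
   other to the loss divided by [tau]. *)
set tau := mu / 4 / (K + 1).
have tau0 : 0 < tau by rewrite !divr_gt0 //; lra.
exists tau, (mu / 4 * tau); split=> [||a t sa loss] //.
  by rewrite mulr_gt0 // divr_gt0.
have h1 := tilt_small sa tau0 loss.
have h2 : K * tau <= mu / 4.
  by rewrite /tau mulrA ler_pdivrMr; nra.
by move: h1; rewrite -/K; lra.
Qed.

(** Tilt at most 3/4 keeps [z_i ^+ 2 >= 1 / 4], so [z_i] keeps the sign it has at [T]; and
    [1 - |z_i| <= 1 - z_i ^+ 2], which the tilt bounds. *)
Lemma pole_near a T t i : solution a -> T <= t ->
  (forall u, T <= u -> tilt (a u) <= 3 / 4) ->
  `|zc (a t) i - (-1) ^+ (zc (a T) i < 0)%R| <= tilt (a t).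
Proof.
move=> sa Tt ht.
have z2 u : T <= u -> 1 / 4 <= zc (a u) i ^+ 2.
  move=> Tu; have := ht u Tu; have := energy_ge (xc (a u)) (yc (a u)) i.
  by rewrite -/(tilt _); have := sa.1 u i; lra.
have zn u : T <= u -> zc (a u) i != 0.
  by move=> /z2; apply: contraTneq => ->; rewrite expr0n /= -ltNge; lra.
have := energy_ge (xc (a t)) (yc (a t)) i; rewrite -/(tilt _) => ti.
apply: le_trans ti.
have [_ _] := sphere_norm i (sa.1 t); rewrite ler_norml => /andP[zm zM].
have St := sa.1 t i.
have [zT|zT|zT] := ltgtP (zc (a T) i) 0; last by have := zn T (lexx _); rewrite zT eqxx.
- have zt : 0 < - zc (a t) i.
    apply: (@const_sign _ (fun u => - zc (a u) i) _ T t) => //.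
    - by move=> u; exact: is_deriveN (solution_z u i sa).
    - by move=> u /andP[Tu _]; rewrite oppr_eq0 zn.
    - by rewrite oppr_gt0.
  by rewrite expr1 ler_norml; apply/andP; split; nra.
- have zt : 0 < zc (a t) i.
    apply: (@const_sign _ (fun u => zc (a u) i) _ T t) => //.
    - by move=> u; exact: solution_z.
    - by move=> u /andP[Tu _]; rewrite zn.
  by rewrite expr0 ler_norml; apply/andP; split; nra.
Qed.

Definition settles a (s : 'I_p -> bool) : Prop :=
  forall mu, 0 < mu -> exists T, forall t, T <= t ->
    tilt (a t) <= mu /\ forall i, `|zc (a t) i - (-1) ^+ s i| <= mu.

(** As [lyap] decreases and is bounded below, late losses are small, hence so is the tilt; the signs
    of the [z_i] are frozen once the tilt is below 3/4. *)
Lemma solution_settles a : solution a -> exists s, settles a s.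
Proof.
move=> sa.
have small mu : 0 < mu -> exists T, forall t, T <= t -> tilt (a t) <= mu.
  move=> /tilt_small_of_loss[tau [eta [tau0 eta0 h]]].
  have [T hT] := nonincreasing_settles (fun s t => lyap_nonincreasing sa)
                   (fun t => lyap_ge (sa.1 t)) eta0.
  by exists T => t Tt; apply: h => //; exact: hT.
have [T0 hT0] := small (3 / 4) ltac:(lra).
exists (fun i => zc (a T0) i < 0) => mu mu0.
have [T hT] := small mu mu0.
exists (Num.max T T0) => t; rewrite ge_max => /andP[Tt T0t].
split=> [|i]; first exact: hT.
by apply: le_trans (hT t Tt); exact: pole_near.
Qed.

Lemma settles_height a s : settles a s -> forall eps, 0 < eps ->
  exists T, forall t, T <= t -> `|height (a t) - pole_height s| <= eps.
Proof.
move=> sa eps eps0; have p1 : 0 < p%:R + 1 :> R by rewrite ltr_wpDl.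
have [T hT] := sa (eps / (p%:R + 1)) (divr_gt0 eps0 p1).
exists T => t /hT[_ h]; rewrite /height /pole_height -sumrB.
apply: le_trans (norm_sum_le h) _.
by rewrite mulrA ler_pdivrMr // mulrC ler_wpM2l ?ltW // ltrDl.
Qed.

(** The observing form is bounded by the tilt and vanishes in the limit, so the limit levels of
    [lyap] are ordered as the pole heights. *)
Lemma settles_lyap a s : settles a s -> forall eps, 0 < eps ->
  exists T, forall t, T <= t ->
    `|lyap (a t) - (1 + obs_gain e) * pole_height s| <= eps.
Proof.
move=> sa eps eps0; have k0 := obs_norm_ge0 e; have g0 := obs_gain_ge0 e.
have M0 : 0 < 1 + obs_gain e by lra.
have N0 : 0 < 1 + obs_norm e by lra.
have e2 : 0 < eps / 2 by lra.
have [T1 h1] := settles_height sa (divr_gt0 e2 M0).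
have [T2 h2] := sa _ (divr_gt0 e2 N0).
exists (Num.max T1 T2) => t; rewrite ge_max => /andP[/h1 {}h1 /h2[{}h2 _]].
have -> : lyap (a t) - (1 + obs_gain e) * pole_height s =
  (1 + obs_gain e) * (height (a t) - pole_height s) - obs e (xc (a t)) (yc (a t)).
  by rewrite /lyap; ring.
rewrite (le_trans (ler_normB _ _)) // normrM gtr0_norm //.
move: h1; rewrite ler_pdivlMr // mulrC => h1.
have h3 : obs_norm e * tilt (a t) <= eps / 2.
  move: h2; rewrite ler_pdivlMr //.
  by have := energy_ge0 (xc (a t)) (yc (a t)); rewrite -/(tilt _); nra.
by have := obs_le e (xc (a t)) (yc (a t)); rewrite -/(tilt _); lra.
Qed.

Lemma lyap_ge_limit a s t : solution a -> settles a s ->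
  (1 + obs_gain e) * pole_height s <= lyap (a t).
Proof.
move=> sa sas; apply/ler_addgt0Pr => eps eps0.
have [T hT] := settles_lyap sas eps0.
have := hT (Num.max t T); rewrite le_max lexx orbT ler_norml => /(_ isT)/andP[h _].
have : lyap (a (Num.max t T)) <= lyap (a t).
  by apply: lyap_nonincreasing => //; rewrite le_max lexx.
by lra.
Qed.

Lemma height_ge_limit a s t : solution a -> settles a s ->
  pole_height s <= height (a t).
Proof.
move=> sa sas; apply/ler_addgt0Pr => eps eps0.
have [T hT] := settles_height sas eps0.
have := hT (Num.max t T); rewrite le_max lexx orbT ler_norml => /(_ isT)/andP[h _].
have : height (a (Num.max t T)) <= height (a t).
  by apply: height_nonincreasing => //; rewrite le_max lexx.
by lra.
Qed.

End Dissipation.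

(** * Two solutions near the same pole configuration separate *)

Section Separation.
Context {R : realType} {p : nat} (e : 'I_p -> R).
Hypothesis e_inj : injective e.
Implicit Types (X Y : 'M[R]_(p, 3)) (a b : R -> 'M[R]_(p, 3)).

Definition dist2 X Y : R :=
  \sum_i ((xc X i - xc Y i) ^+ 2 + (yc X i - yc Y i) ^+ 2 + (zc X i - zc Y i) ^+ 2).

Lemma dist2_coord X Y i :
  [/\ (xc X i - xc Y i) ^+ 2 <= dist2 X Y, (yc X i - yc Y i) ^+ 2 <= dist2 X Y &
      (zc X i - zc Y i) ^+ 2 <= dist2 X Y].
Proof.
have h0 : 0 <= \sum_(k | k != i) ((xc X k - xc Y k) ^+ 2 + (yc X k - yc Y k) ^+ 2
                                  + (zc X k - zc Y k) ^+ 2).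
  by apply: sumr_ge0 => k _; rewrite !addr_ge0 ?sqr_ge0.
have hx := sqr_ge0 (xc X i - xc Y i); have hy := sqr_ge0 (yc X i - yc Y i).
have hz := sqr_ge0 (zc X i - zc Y i).
by rewrite /dist2 (bigD1 i) //=; split; lra.
Qed.

Lemma dist2xx X : dist2 X X = 0.
Proof. by rewrite /dist2 big1 // => i _; rewrite !subrr expr0n /= !addr0. Qed.

Lemma coord_matrix X Y : (forall i, xc X i = xc Y i) -> (forall i, yc X i = yc Y i) ->
  (forall i, zc X i = zc Y i) -> X = Y.
Proof.
move=> hx hy hz; apply/matrixP => i k.
have [k0|[k1|k2]] : k = 0 \/ k = 1 \/ k = 2.
  by case: k => [[|[|[|//]]]] hk; [left|right; left|right; right]; apply: val_inj.
- by rewrite k0; exact: hx.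
- by rewrite k1; exact: hy.
- by rewrite k2; exact: hz.
Qed.

Lemma dist2_eq0 X Y : dist2 X Y <= 0 -> X = Y.
Proof.
move=> d0; have sq0 (u v : R) : (u - v) ^+ 2 <= dist2 X Y -> u = v.
  move=> h; apply/eqP; rewrite -subr_eq0 -(sqrf_eq0 (u - v)) eq_le sqr_ge0 andbT.
  exact: le_trans d0.
by apply: coord_matrix => i; apply: sq0; have [] := dist2_coord X Y i.
Qed.

Lemma norm_mul_le (u v D : R) : u ^+ 2 <= D -> v ^+ 2 <= D -> `|u * v| <= D.
Proof. by move=> hu hv; rewrite ler_norml; nra. Qed.

Lemma norm_le_of_sqr (u d : R) : 0 <= d -> u ^+ 2 <= d ^+ 2 -> `|u| <= d.
Proof.
by move=> d0; rewrite -(real_normK (num_real u)) ler_pXn2r ?nnegrE.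
Qed.

Lemma norm_sum_mul_le (f : 'I_p -> R) v D :
  (forall i, f i ^+ 2 <= D) -> v ^+ 2 <= D -> `|(\sum_i f i) * v| <= p%:R * D.
Proof.
move=> hf hv; rewrite mulr_suml; apply: norm_sum_le => i.
exact: norm_mul_le.
Qed.

Lemma norm_mul_le1 (u v B : R) : `|u| <= B -> `|v| <= 1 -> `|u * v| <= B.
Proof.
move=> hu hv; rewrite normrM -[leRHS]mulr1.
by apply: ler_pM.
Qed.

Lemma feedback1B X Y : feedback1 X - feedback1 Y = \sum_i (yc X i - yc Y i).
Proof. by rewrite sumrB. Qed.

Lemma feedback2B X Y : feedback2 X - feedback2 Y = \sum_i (xc X i - xc Y i).
Proof. by rewrite sumrB. Qed.

(** Under frozen controls each row undergoes an infinitesimal rotation, an isometry; only the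
    difference of the controls contributes. This leaves [p] rows of four products, each at most
    [p%:R * D], doubled. *)
Lemma solution_dist2 a b t : solution e a -> solution e b ->
  exists2 d, is_derive t (1 : R) (fun u => dist2 (a u) (b u)) d &
    `|d| <= 8 * p%:R ^+ 2 * dist2 (a t) (b t).
Proof.
move=> sa sb; set X := a t; set Y := b t; set D := dist2 X Y.
pose d := \sum_i 2 * ((feedback2 X - feedback2 Y) * (xc X i - xc Y i) * zc X i -
                      (feedback2 X - feedback2 Y) * (zc X i - zc Y i) * xc X i +
                      (feedback1 X - feedback1 Y) * (yc X i - yc Y i) * zc X i -
                      (feedback1 X - feedback1 Y) * (zc X i - zc Y i) * yc X i).
exists d.
  apply: is_derive_eq (is_derive_sumf (fun i => is_derive_addf (is_derive_addf
    (is_derive_sqrf (is_derive_subf (solution_x t i sa) (solution_x t i sb)))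
    (is_derive_sqrf (is_derive_subf (solution_y t i sa) (solution_y t i sb))))
    (is_derive_sqrf (is_derive_subf (solution_z t i sa) (solution_z t i sb))))) _.
  by apply: eq_bigr => i _; rewrite -/X -/Y; ring.
have -> : 8 * p%:R ^+ 2 * D = p%:R * (2 * (4 * (p%:R * D))) by ring.
apply: norm_sum_le => i; rewrite normrM ger0_norm // ler_pM2l //.
have [hx hy hz] := dist2_coord X Y i.
have [nx ny nz] := sphere_norm i (sa.1 t); rewrite -/X in nx ny nz.
have f1 v : v ^+ 2 <= D -> `|(feedback1 X - feedback1 Y) * v| <= p%:R * D.
  by rewrite feedback1B; apply: norm_sum_mul_le => j; have [] := dist2_coord X Y j.
have f2 v : v ^+ 2 <= D -> `|(feedback2 X - feedback2 Y) * v| <= p%:R * D.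
  by rewrite feedback2B; apply: norm_sum_mul_le => j; have [] := dist2_coord X Y j.
have := norm_mul_le1 (f2 _ hx) nz; have := norm_mul_le1 (f2 _ hz) nx.
have := norm_mul_le1 (f1 _ hy) nz; have := norm_mul_le1 (f1 _ hz) ny.
by rewrite !ler_norml; lra.
Qed.

Lemma solution_dist2_fun a b : solution e a -> solution e b ->
  exists2 d : R -> R, forall t, is_derive t (1 : R) (fun u => dist2 (a u) (b u)) (d t) &
    forall t, `|d t| <= 8 * p%:R ^+ 2 * dist2 (a t) (b t).
Proof.
move=> sa sb; exists (fun t => projT1 (cid2 (solution_dist2 t sa sb))) => t;
  by case: (cid2 (solution_dist2 t sa sb)).
Qed.

(** Forwards in time, Gronwall is applied to the negated distance; backwards, to the distance with
    rate [- K]. *)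
Lemma dist2_solutions a b s t : solution e a -> solution e b ->
  dist2 (a t) (b t) <= dist2 (a s) (b s) * expR (8 * p%:R ^+ 2 * `|t - s|).
Proof.
move=> sa sb; have [d hd dle] := solution_dist2_fun sa sb.
set K := 8 * p%:R ^+ 2.
have [st|ts] := leP s t.
  have hN u : is_derive u (1 : R) (fun v => - dist2 (a v) (b v)) (- d u).
    exact: is_deriveN.
  have := @gronwall_ge _ _ _ K s t hN st.
  rewrite mulNr lerN2 ger0_norm ?subr_ge0 //; apply => u _.
  by rewrite mulrN lerN2; apply: le_trans (dle u); exact: ler_norm.
have := @gronwall_ge _ _ _ (- K) t s hd (ltW ts).
rewrite distrC ger0_norm ?subr_ge0 ?(ltW ts) // => h.
rewrite -(ler_pM2r (expR_gt0 (- K * (s - t)))) -mulrA -expRD mulNr subrr expR0 mulr1.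
rewrite -mulNr; apply: h => u _.
by rewrite mulNr lerNl; apply: le_trans (dle u); rewrite -normrN ler_norm.
Qed.

Lemma solution_unique a b s t : solution e a -> solution e b -> a s = b s -> a t = b t.
Proof.
move=> sa sb ab; apply: dist2_eq0; apply: le_trans (dist2_solutions s t sa sb) _.
by rewrite ab dist2xx mul0r.
Qed.

Definition gap X Y : R := energy (fun i => xc X i - xc Y i) (fun i => yc X i - yc Y i).

Definition sgap (s : 'I_p -> bool) X Y : R :=
  \sum_i (-1) ^+ s i * ((xc X i - xc Y i) ^+ 2 + (yc X i - yc Y i) ^+ 2).

(** The growth of [sgap] must repay the squared control differences that [obs_dissipation] costs:
    once directly, and twice [obs_gain e] through the forcing bound. *)
Definition separation (s : 'I_p -> bool) X Y : R :=
  (1 + 2 * obs_gain e) * sgap s X Y +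
  obs e (fun i => xc X i - xc Y i) (fun i => yc X i - yc Y i).

Lemma separation_le s X Y :
  separation s X Y <= (1 + 2 * obs_gain e + obs_norm e) * gap X Y.
Proof.
have g0 := obs_gain_ge0 e; rewrite mulrDl; apply: lerD.
  apply: ler_wpM2l; first by lra.
  apply: ler_sum => i _; case: (s i); rewrite ?expr0 ?expr1 ?mul1r // mulN1r.
  by have := sqr_ge0 (xc X i - xc Y i); have := sqr_ge0 (yc X i - yc Y i); lra.
exact: le_trans (ler_norm _) (obs_le _ _ _).
Qed.

Definition near_pole (s : 'I_p -> bool) (th : R) X : Prop :=
  tilt X <= th ^+ 2 /\ forall i, `|zc X i - (-1) ^+ s i| <= th.

Lemma near_pole_gap s th X Y : near_pole s th X -> near_pole s th Y ->
  gap X Y <= 4 * th ^+ 2.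
Proof.
move=> [hX _] [hY _]; have -> : 4 * th ^+ 2 = 2 * th ^+ 2 + 2 * th ^+ 2 by ring.
have : gap X Y <= 2 * tilt X + 2 * tilt Y; last by lra.
rewrite /gap /tilt /energy !mulr_sumr -big_split; apply: ler_sum => i _ /=.
have := sqr_ge0 (xc X i + xc Y i); have := sqr_ge0 (yc X i + yc Y i).
by lra.
Qed.

(** Subtracting the two sphere equations expresses [(z - z') * (z + z')] by the horizontal
    differences. Near a common pole [|z + z'| >= 1], and Cauchy-Schwarz concludes. *)
Lemma near_pole_dz s th X Y i : spheres X -> spheres Y -> th <= 1 / 2 -> 0 <= th ->
  near_pole s th X -> near_pole s th Y -> (zc X i - zc Y i) ^+ 2 <= gap X Y.
Proof.
move=> /(_ i) SX /(_ i) SY th1 th0 [tX /(_ i) zX] [tY /(_ i) zY].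
have := energy_ge (xc X) (yc X) i; have := energy_ge (xc Y) (yc Y) i.
rewrite -/(tilt X) -/(tilt Y) => eY eX.
have := energy_ge (fun i => xc X i - xc Y i) (fun i => yc X i - yc Y i) i.
rewrite -/(gap X Y) /=; apply: le_trans.
move: SX SY eX eY zX zY; move: (xc X i) (yc X i) (zc X i) (xc Y i) (yc Y i) (zc Y i).
move=> x y z x' y' z' SX SY eX eY zX zY.
have th2 : th ^+ 2 <= 1 / 4 by nra.
have zz : 1 <= (z + z') ^+ 2.
  move: zX zY; case: (s i); rewrite ?expr1 ?expr0 !ler_norml; nra.
have xy : (x + x') ^+ 2 + (y + y') ^+ 2 <= 1.
  have := sqr_ge0 (x - x'); have := sqr_ge0 (y - y'); lra.
have eqz : (z - z') * (z + z') = - ((x - x') * (x + x') + (y - y') * (y + y')).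
  by lra.
have cs : ((x - x') * (x + x') + (y - y') * (y + y')) ^+ 2 <=
          ((x - x') ^+ 2 + (y - y') ^+ 2) * ((x + x') ^+ 2 + (y + y') ^+ 2).
  by have := sqr_ge0 ((x - x') * (y + y') - (y - y') * (x + x')); lra.
have h1 : (z - z') ^+ 2 <= ((z - z') * (z + z')) ^+ 2.
  by rewrite exprMn ler_peMr ?sqr_ge0.
apply: (le_trans h1); rewrite eqz sqrrN; apply: (le_trans cs).
by rewrite ler_piMr // addr_ge0 ?sqr_ge0.
Qed.

Lemma near_pole_feedback s th X : near_pole s th X -> 0 <= th ->
  `|feedback1 X| <= p%:R * th /\ `|feedback2 X| <= p%:R * th.
Proof.
move=> [tX _] th0; split; apply: norm_sum_le => i.
  by apply: norm_le_of_sqr => //; exact: le_trans (energy_ger (xc X) (yc X) i) tX.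
by apply: norm_le_of_sqr => //; exact: le_trans (energy_gel (xc X) (yc X) i) tX.
Qed.

(** The right side is the derivative of [sgap], where the rotations cancel. At the poles
    [(-1) ^+ s i * z_i = 1], so every row contributes with the same sign and the sum is twice the
    squared control differences; the deviation is of order [th]. *)
Lemma sgap_growth s th X Y : 0 <= th <= 1 / 2 -> spheres X -> spheres Y ->
  near_pole s th X -> near_pole s th Y ->
  2 * ((feedback2 X - feedback2 Y) ^+ 2 + (feedback1 X - feedback1 Y) ^+ 2)
    - 8 * p%:R ^+ 2 * th * gap X Y <=
  \sum_i (-1) ^+ s i *
    (2 * (xc X i - xc Y i) * (feedback2 X * zc X i - feedback2 Y * zc Y i) +
     2 * (yc X i - yc Y i) * (feedback1 X * zc X i - feedback1 Y * zc Y i)).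
Proof.
move=> /andP[th0 th1] SX SY nX nY.
set A := feedback2 X - feedback2 Y; set B := feedback1 X - feedback1 Y.
set N := gap X Y; have N0 : 0 <= N by exact: energy_ge0.
have hx i : (xc X i - xc Y i) ^+ 2 <= N.
  exact: (energy_gel (fun i => xc X i - xc Y i) (fun i => yc X i - yc Y i) i).
have hy i : (yc X i - yc Y i) ^+ 2 <= N.
  exact: (energy_ger (fun i => xc X i - xc Y i) (fun i => yc X i - yc Y i) i).
have [f1 f2] := near_pole_feedback nY th0.
have -> : 2 * (A ^+ 2 + B ^+ 2) - 8 * p%:R ^+ 2 * th * N =
  \sum_i (2 * (A * (xc X i - xc Y i)) + 2 * (B * (yc X i - yc Y i)) - 8 * (p%:R * th * N)).
  rewrite sumrB big_split /= -!mulr_sumr -feedback1B -feedback2B -/A -/B.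
  by rewrite sumr_const card_ord -mulr_natl; ring.
apply: ler_sum => i _.
have hz : (zc X i - zc Y i) ^+ 2 <= N by exact: near_pole_dz nX nY.
have AN : `|A * (xc X i - xc Y i)| <= p%:R * N.
  by rewrite /A feedback2B; apply: norm_sum_mul_le.
have BN : `|B * (yc X i - yc Y i)| <= p%:R * N.
  by rewrite /B feedback1B; apply: norm_sum_mul_le.
have mulb (u v al be : R) : `|u| <= al -> `|v| <= be -> `|u * v| <= al * be.
  by move=> hu hv; rewrite normrM ler_pM.
have e1 := mulb _ _ _ _ AN (nX.2 i); have e2 := mulb _ _ _ _ BN (nX.2 i).
have e3 := mulb _ _ _ _ f2 (norm_mul_le (hx i) hz).
have e4 := mulb _ _ _ _ f1 (norm_mul_le (hy i) hz).
have -> : feedback2 X * zc X i - feedback2 Y * zc Y i =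
  A * zc X i + feedback2 Y * (zc X i - zc Y i) by rewrite /A; ring.
have -> : feedback1 X * zc X i - feedback1 Y * zc Y i =
  B * zc X i + feedback1 Y * (zc X i - zc Y i) by rewrite /B; ring.
move: e1 e2 e3 e4; rewrite !ler_norml.
by case: (s i); rewrite ?expr0 ?expr1 => /andP[? ?] /andP[? ?] /andP[? ?] /andP[? ?]; lra.
Qed.

Lemma separation_growth s th a b t : 0 <= th <= 1 / 2 ->
  40 * (1 + 2 * obs_gain e) * p%:R ^+ 2 * th <= 1 ->
  solution e a -> solution e b ->
  exists2 d, is_derive t (1 : R) (fun u => separation s (a u) (b u)) d &
    near_pole s th (a t) -> near_pole s th (b t) -> gap (a t) (b t) / 4 <= d.
Proof.
move=> th01 thM sa sb; have /andP[th0 th1] := th01.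
pose g i := feedback2 (a t) * zc (a t) i - feedback2 (b t) * zc (b t) i.
pose h i := feedback1 (a t) * zc (a t) i - feedback1 (b t) * zc (b t) i.
pose dx i := xc (a t) i - xc (b t) i; pose dy i := yc (a t) i - yc (b t) i.
have hdx i : is_derive t (1 : R) (fun u => xc (a u) i - xc (b u) i) (- e i * dy i + g i).
  apply: is_derive_eq (is_derive_subf (solution_x t i sa) (solution_x t i sb)) _.
  by rewrite /dy /g; ring.
have hdy i : is_derive t (1 : R) (fun u => yc (a u) i - yc (b u) i) (e i * dx i + h i).
  apply: is_derive_eq (is_derive_subf (solution_y t i sa) (solution_y t i sb)) _.
  by rewrite /dx /h; ring.
have hQ := is_derive_mulcf (1 + 2 * obs_gain e) (is_derive_sumf (fun i =>
  is_derive_mulcf ((-1) ^+ s i)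
    (is_derive_addf (is_derive_sqrf (hdx i)) (is_derive_sqrf (hdy i))))).
have hR := is_derive_obs e hdx hdy.
eexists; first exact: (is_derive_addf hQ hR).
move=> na nb.
rewrite -/(dx _) -/(dy _).
have g0 := obs_gain_ge0 e.
set N := gap (a t) (b t); have N0 : 0 <= N by exact: energy_ge0.
set A := feedback2 (a t) - feedback2 (b t); set B := feedback1 (a t) - feedback1 (b t).
have [f1 f2] := near_pole_feedback nb th0.
have A0 := sqr_ge0 A; have B0 := sqr_ge0 B.
set m := 2 * (A ^+ 2 + B ^+ 2) + 2 * (p%:R * th) ^+ 2 * N.
have sqD (u v w : R) : u ^+ 2 <= w ^+ 2 -> (u * v) ^+ 2 <= w ^+ 2 * v ^+ 2.
  by move=> uw; rewrite exprMn ler_wpM2r ?sqr_ge0.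
have small (c c' z z' f : R) : z ^+ 2 <= 1 -> (z - z') ^+ 2 <= N -> `|c'| <= p%:R * th ->
    c - c' = f -> (c * z - c' * z') ^+ 2 <= 2 * f ^+ 2 + 2 * (p%:R * th) ^+ 2 * N.
  move=> z1 dz cth fE; have -> : c * z - c' * z' = f * z + c' * (z - z') by rewrite -fE; ring.
  have c2 : c' ^+ 2 <= (p%:R * th) ^+ 2.
    by rewrite -(real_normK (num_real c')) ler_pXn2r ?nnegrE // mulr_ge0.
  have i1 : (f * z) ^+ 2 <= f ^+ 2 by rewrite exprMn ler_piMr ?sqr_ge0.
  have i2 : (c' * (z - z')) ^+ 2 <= (p%:R * th) ^+ 2 * N.
    by rewrite exprMn ler_pM ?sqr_ge0.
  by have := sqr_ge0 (f * z - c' * (z - z')); lra.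
have z1 i : zc (a t) i ^+ 2 <= 1.
  by have := sa.1 t i; have := sqr_ge0 (xc (a t) i); have := sqr_ge0 (yc (a t) i); lra.
have hz i : (zc (a t) i - zc (b t) i) ^+ 2 <= N.
  exact: near_pole_dz (sa.1 t) (sb.1 t) th1 th0 na nb.
have gm i : g i ^+ 2 <= m.
  by apply: le_trans (small _ _ _ _ A (z1 i) (hz i) f2 erefl) _; rewrite /m; lra.
have hm i : h i ^+ 2 <= m.
  by apply: le_trans (small _ _ _ _ B (z1 i) (hz i) f1 erefl) _; rewrite /m; lra.
have := obs_dissipation e_inj dx dy gm hm.
rewrite -feedback1B -feedback2B -/A -/B.
have -> : energy dx dy = N by [].
have := sgap_growth th01 (sa.1 t) (sb.1 t) na nb; rewrite -/A -/B -/N.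
have -> : \sum_i (-1) ^+ s i *
     (2 * (xc (a t) i - xc (b t) i) *
      (feedback2 (a t) * zc (a t) i - feedback2 (b t) * zc (b t) i) +
      2 * (yc (a t) i - yc (b t) i) *
      (feedback1 (a t) * zc (a t) i - feedback1 (b t) * zc (b t) i)) =
   \sum_i (-1) ^+ s i * (2 * dx i * (- e i * dy i + g i) + 2 * dy i * (e i * dx i + h i)).
  by apply: eq_bigr => i _; rewrite -/(dx i) -/(dy i) -/(g i) -/(h i); ring.
move: (\sum_i (-1) ^+ s i * _) => Q1 hQ1.
move: (\sum_i \sum_j _) => R1 hR1.
set C := obs_gain e in g0 hR1 thM *.
have h1 : (1 + 2 * C) * (2 * (A ^+ 2 + B ^+ 2) - 8 * p%:R ^+ 2 * th * N) <= (1 + 2 * C) * Q1.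
  by rewrite ler_wpM2l //; lra.
have p0 : 0 <= p%:R ^+ 2 * th :> R by rewrite mulr_ge0 ?sqr_ge0.
have h2 : (p%:R * th) ^+ 2 * N <= p%:R ^+ 2 * th * N.
  by rewrite ler_wpM2r // exprMn ler_wpM2l ?sqr_ge0 // expr2 ler_piMr //; lra.
have h3 : C * ((p%:R * th) ^+ 2 * N) <= C * (p%:R ^+ 2 * th * N) by rewrite ler_wpM2l.
(* The errors add up to at most [9 * (1 + 2 * C) * p%:R ^+ 2 * th * N], less than the quarter of [N]
   to be spared from [N / 2]. *)
have h4 : 40 * (1 + 2 * C) * p%:R ^+ 2 * th * N <= N by rewrite ler_piMl.
have h5 : 0 <= p%:R ^+ 2 * th * N by rewrite mulr_ge0.
have h6 : 0 <= C * (p%:R ^+ 2 * th * N) by rewrite mulr_ge0.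
have h7 : 0 <= C * (A ^+ 2 + B ^+ 2) by rewrite mulr_ge0 // addr_ge0.
by move: hR1; rewrite /m => hR1; lra.
Qed.

(** A positive value would grow exponentially at rate [(4 * K)^-1], whereas near the poles the gap
    is at most 1 and the form at most [K]. *)
Lemma separation_le0 s th a b T : 0 <= th <= 1 / 2 ->
  40 * (1 + 2 * obs_gain e) * p%:R ^+ 2 * th <= 1 ->
  solution e a -> solution e b ->
  (forall t, T <= t -> near_pole s th (a t) /\ near_pole s th (b t)) ->
  separation s (a T) (b T) <= 0.
Proof.
move=> th01 thM sa sb nab; rewrite leNgt; apply/negP => P0.
have g0 := obs_gain_ge0 e; have k0 := obs_norm_ge0 e.
set K := 1 + 2 * obs_gain e + obs_norm e.
have K0 : 0 < K by rewrite /K; lra.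
pose ex t := cid2 (separation_growth s t th01 thM sa sb).
pose d t := projT1 (ex t).
have hd t : is_derive t (1 : R) (fun u => separation s (a u) (b u)) (d t).
  by rewrite /d; case: (ex t).
have dge t : T <= t -> gap (a t) (b t) / 4 <= d t.
  by move=> /nab[na nb]; rewrite /d; case: (ex t) => ? /= _; apply.
set c := (4 * K)^-1; have c0 : 0 < c by rewrite invr_gt0 mulr_gt0.
set P := separation s (a T) (b T) in P0 *.
(* At this time the linear bound [1 + x <= expR x] already gives the value [P + K]. *)
set t := T + K / (c * P).
have Tt : T <= t by rewrite lerDl divr_ge0 ?mulr_ge0 ?ltW.
have h1 : P * expR (c * (t - T)) <= separation s (a t) (b t).
  apply: (gronwall_ge hd Tt) => u /andP[Tu _]; apply: le_trans (dge u Tu).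
  rewrite /c mulrC ler_pdivrMr ?mulr_gt0 //.
  have := separation_le s (a u) (b u); rewrite -/K.
  by lra.
have h2 : separation s (a t) (b t) <= K.
  apply: le_trans (separation_le _ _ _) _; rewrite -/K ler_piMr ?(ltW K0) //.
  have [na nb] := nab t Tt; apply: le_trans (near_pole_gap na nb) _.
  by have /andP[] := th01; nra.
have h3 : P * (1 + c * (t - T)) <= P * expR (c * (t - T)).
  by rewrite ler_pM2l // expR_ge1Dx.
have h4 : P * (c * (t - T)) = K.
  rewrite /t; have -> : T + K / (c * P) - T = K / (c * P) by ring.
  by field; rewrite !gt_eqF.
by lra.
Qed.

Lemma height_lipschitz X Y d : 0 <= d -> dist2 X Y <= d ^+ 2 ->
  height Y <= height X + p%:R * d.
Proof.
move=> d0 XY; rewrite -lerBlDl /height -sumrB (le_trans (ler_norm _)) //.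
apply: norm_sum_le => i; rewrite distrC; apply: norm_le_of_sqr => //.
by have [_ _ h] := dist2_coord X Y i; exact: le_trans XY.
Qed.

Lemma lyap_lipschitz X Y d : spheres X -> spheres Y -> 0 <= d ->
  dist2 X Y <= d ^+ 2 ->
  lyap e Y <= lyap e X + ((1 + obs_gain e) * p%:R + 2 * obs_norm e) * d.
Proof.
move=> SX SY d0 XY; have g0 := obs_gain_ge0 e; have k0 := obs_norm_ge0 e.
have nd (u : R) : u ^+ 2 <= dist2 X Y -> `|u| <= d.
  by move=> u2; apply: norm_le_of_sqr => //; exact: le_trans XY.
have hh : height Y - height X <= p%:R * d by rewrite lerBlDl height_lipschitz.
have hh2 : (1 + obs_gain e) * (height Y - height X) <= (1 + obs_gain e) * (p%:R * d).
  by rewrite ler_wpM2l //; lra.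
have ho : obs e (xc X) (yc X) - obs e (xc Y) (yc Y) <= 2 * obs_norm e * d.
  rewrite (le_trans (ler_norm _)) // /obs /obs_norm -sumrB mulr_sumr mulr_suml.
  rewrite (le_trans (ler_norm_sum _ _ _)) //; apply: ler_sum => i _.
  rewrite -sumrB mulr_sumr mulr_suml (le_trans (ler_norm_sum _ _ _)) //.
  apply: ler_sum => j _; rewrite -mulrBr normrM.
  have -> : 2 * `|obs_coef e i j| * d = `|obs_coef e i j| * (2 * d) by ring.
  rewrite ler_wpM2l //.
  have [/nd hx _ _] := dist2_coord X Y i; have [_ /nd hy _] := dist2_coord X Y j.
  have [_ yX _] := sphere_norm j SX; have [xY _ _] := sphere_norm i SY.
  have -> : xc X i * yc X j - xc Y i * yc Y j =
    (xc X i - xc Y i) * yc X j + (yc X j - yc Y j) * xc Y i by ring.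
  have := norm_mul_le1 hx yX; have := norm_mul_le1 hy xY.
  by rewrite !ler_norml; lra.
by rewrite /lyap; lra.
Qed.

(** One vector moves and its [y] entry is kept, so the observing form of the difference is 0 and
    [separation] reduces to one square, positive if [j] is at the north pole. *)
Lemma perturb X j d : spheres X -> 1 / 2 <= zc X j -> 0 < d ->
  exists Y, [/\ spheres Y, dist2 X Y <= d ^+ 2, forall i, yc Y i = yc X i,
    xc Y j != xc X j & forall i, i != j -> xc Y i = xc X i].
Proof.
move=> SX zj d0; have Sj := SX j.
(* The displacement is at most [2 * u]; [u <= 1 / 4] keeps [z_j - u * x_j] positive, so that [x_j]
   does change. *)
set u := Num.min (d / 2) (1 / 4).
have u0 : 0 < u by rewrite lt_min; apply/andP; split; lra.
have u4 : u <= 1 / 4 by rewrite ge_min lexx orbT.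
have ud : 2 * u <= d by have : u <= d / 2; [rewrite ge_min lexx|lra].
have q0 : 0 < 1 + u ^+ 2 by rewrite ltr_wpDr ?sqr_ge0.
have qn : 1 + u ^+ 2 != 0 by rewrite gt_eqF.
(* Rotation of the j-th vector about the y axis, of angle 2 * atan u. *)
pose x' := ((1 - u ^+ 2) * xc X j + 2 * u * zc X j) / (1 + u ^+ 2).
pose z' := ((1 - u ^+ 2) * zc X j - 2 * u * xc X j) / (1 + u ^+ 2).
pose Y : 'M[R]_(p, 3) := \matrix_(i, k)
  [:: if i == j then x' else xc X i; yc X i; if i == j then z' else zc X i]`_k.
have Yx i : xc Y i = if i == j then x' else xc X i by rewrite /xc mxE.
have Yy i : yc Y i = yc X i by rewrite /yc mxE.
have Yz i : zc Y i = if i == j then z' else zc X i by rewrite /zc mxE.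
exists Y; split=> // [i||| i ij].
- rewrite Yx Yy Yz; case: eqP => [->|_]; last exact: SX.
  have -> : x' ^+ 2 + yc X j ^+ 2 + z' ^+ 2 = xc X j ^+ 2 + yc X j ^+ 2 + zc X j ^+ 2.
    by rewrite /x' /z'; field.
  exact: SX.
- rewrite /dist2 (bigD1 j) //= big1 => [|i ij]; last first.
    by rewrite Yx Yy Yz (negbTE ij) !subrr expr0n /= !addr0.
  rewrite Yx Yy Yz eqxx.
  have -> : (xc X j - x') ^+ 2 + (yc X j - yc X j) ^+ 2 + (zc X j - z') ^+ 2 + 0 =
    (2 * u) ^+ 2 * ((xc X j ^+ 2 + zc X j ^+ 2) / (1 + u ^+ 2)).
    by rewrite /x' /z'; field.
  apply: (@le_trans _ _ ((2 * u) ^+ 2)); last by rewrite ler_pXn2r ?nnegrE //; lra.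
  rewrite ler_piMr ?sqr_ge0 // ler_pdivrMr // mul1r.
  by have := sqr_ge0 u; have := sqr_ge0 (yc X j); lra.
- rewrite Yx eqxx -subr_eq0.
  have -> : x' - xc X j = 2 * u * (zc X j - u * xc X j) / (1 + u ^+ 2).
    by rewrite /x'; field.
  rewrite !mulf_neq0 ?invr_eq0 // ?gt_eqF //.
  by have [+ _ _] := sphere_norm j SX; rewrite ler_norml => /andP[]; nra.
- by rewrite Yx (negbTE ij).
Qed.

Lemma separation_perturb s X Y j : ~~ s j -> (forall i, yc Y i = yc X i) ->
  xc Y j != xc X j -> (forall i, i != j -> xc Y i = xc X i) ->
  0 < separation s X Y.
Proof.
move=> sj hy hxj hx; rewrite /separation /sgap (bigD1 j) //= (negbTE sj) expr0.
rewrite big1 => [|i ij]; last by rewrite hx // hy !subrr expr0n /= addr0 mulr0.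
have -> : obs e (fun i => xc X i - xc Y i) (fun i => yc X i - yc Y i) = 0.
  rewrite /obs big1 // => i _; rewrite big1 // => k _.
  by rewrite hy subrr !mulr0.
rewrite hy subrr expr0n /= !addr0 mul1r mulr_gt0 //.
  by have := obs_gain_ge0 e; lra.
by rewrite lt0r sqr_ge0 sqrf_eq0 subr_eq0 eq_sym hxj.
Qed.

End Separation.

(** * Descent to the south pole configuration *)

Section Descent.
Context {R : realType} {p : nat} (e : 'I_p -> R).
Hypothesis e_inj : injective e.
Hypothesis extend : forall (T : R) (X : 'M[R]_(p, 3)),
  spheres X -> exists2 a, solution e a & a T = X.
Implicit Types (X Y : 'M[R]_(p, 3)) (a b : R -> 'M[R]_(p, 3)) (s : 'I_p -> bool).

Lemma descend a s j r : solution e a -> settles a s -> ~~ s j -> 0 < r ->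
  exists b s', [/\ solution e b, dist2 (a 0) (b 0) <= r, settles b s' &
    pole_height s' < pole_height s :> R].
Proof.
move=> sa sas sj r0; have g0 := obs_gain_ge0 e; have k0 := obs_norm_ge0 e.
have p2 : 0 <= p%:R ^+ 2 :> R by exact: sqr_ge0.
(* The inverse of [D] is the radius [th] required by [separation_le0]; the added 1 gives
   [th <= 1 / 40] whatever [p]. *)
set D := 40 * (1 + 2 * obs_gain e) * (p%:R ^+ 2 + 1).
have D40 : 40 <= D by rewrite /D; nra.
have D0 : 0 < D by lra.
pose th := D^-1.
have th0 : 0 < th by rewrite invr_gt0.
have th4 : th <= 1 / 40 by rewrite /th div1r lef_pV2 ?posrE.
have thM : 40 * (1 + 2 * obs_gain e) * p%:R ^+ 2 * th <= 1.
  by rewrite ler_pdivrMr // mul1r /D; nra.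
have th2 : 0 < th ^+ 2 by rewrite exprn_gt0.
have th2th : th ^+ 2 <= th by rewrite expr2 ler_piMr; lra.
have [tau [eta [tau0 eta0 loss]]] := tilt_small_of_loss e_inj th2.
have [T1 hT1] := sas _ th2.
have eta2 : 0 < eta / 2 by lra.
have [T2 hT2] := settles_lyap e sas eta2.
set T := Num.max T1 T2.
have na t : T <= t -> near_pole s th (a t).
  rewrite ge_max => /andP[/hT1[h1 h2] _]; split=> // i.
  exact: le_trans (h2 i) th2th.
have lT : lyap e (a T) <= (1 + obs_gain e) * pole_height s + eta / 2.
  have := hT2 T; rewrite le_max lexx orbT ler_norml => /(_ isT)/andP[_].
  by lra.
set E := expR (8 * p%:R ^+ 2 * `|0 - T|); have E0 : 0 < E by exact: expR_gt0.
set L := (1 + obs_gain e) * p%:R + 2 * obs_norm e.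
have L0 : 0 <= L by rewrite addr_ge0 ?mulr_ge0 //; lra.
(* The three bounds preserve the signs of the [z_i], raise [lyap] by at most [eta / 2], and keep the
   perturbation within [r] once carried back to time 0. *)
set d := Num.min (1 / 4) (Num.min (eta / 2 / (L + 1)) (r / E)).
have L1 : 0 < L + 1 by lra.
have d0 : 0 < d by rewrite !lt_min !divr_gt0.
have d4 : d <= 1 / 4 by rewrite ge_min lexx.
have dL : d * (L + 1) <= eta / 2 by rewrite -ler_pdivlMr // !ge_min lexx !orbT.
have dE : d * E <= r by rewrite -ler_pdivlMr // !ge_min lexx !orbT.
have zT i := (na T (lexx _)).2 i.
have zj : 1 / 2 <= zc (a T) j.
  by have := zT j; rewrite (negbTE sj) expr0 ler_norml => /andP[]; lra.
have [Y [SY XY Yy Yxj Yx]] := perturb (sa.1 T) zj d0.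
have [b sb bT] := extend T SY.
have [s' sbs] := solution_settles e_inj sb.
exists b, s'; split=> //.
  apply: le_trans (dist2_solutions T 0 sa sb) _; rewrite bT -/E.
  apply: le_trans dE; rewrite ler_pM2r //; apply: (le_trans XY).
  by rewrite expr2 ler_piMr //; lra.
rewrite ltNge; apply/negP => ss'.
have := separation_perturb e sj Yy Yxj Yx; rewrite -bT; apply/negP; rewrite -leNgt.
apply: (@separation_le0 _ _ _ e_inj s th) => //; first by lra.
move=> t Tt; split; first exact: na.
(* Past [T], [lyap] along [b] is caught between the level of [s'], supposed at least that of [s],
   and the level of [s] plus [eta]; no window can lose more than [eta]. *)
have bl t' : T <= t' -> lyap e (b t') <= (1 + obs_gain e) * pole_height s + eta.
  move=> Tt'; apply: le_trans (lyap_nonincreasing e_inj sb Tt') _; rewrite bT.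
  have := lyap_lipschitz e (sa.1 T) SY (ltW d0) XY; rewrite -/L.
  by lra.
have tb t' : T <= t' -> tilt (b t') <= th ^+ 2.
  move=> Tt'; apply: loss => //.
  have := lyap_ge_limit e_inj (t' + tau) sb sbs; have := bl t' Tt'.
  have : (1 + obs_gain e) * pole_height s <= (1 + obs_gain e) * pole_height s'.
    by rewrite ler_wpM2l //; lra.
  by lra.
split=> [|i]; first exact: tb.
have -> : s i = (zc (b T) i < 0)%R.
  have [_ _ /=] := dist2_coord (a T) (b T) i; rewrite bT => dz.
  have := norm_le_of_sqr (ltW d0) (le_trans dz XY).
  have := zT i; rewrite !ler_norml => /andP[z1 z2] /andP[z3 z4].
  move: z1 z2; case: (s i); rewrite ?expr0 ?expr1 => z1 z2; apply/esym.
    by lra.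
  by apply/negbTE; rewrite -leNgt; lra.
apply: le_trans (le_trans (tb t Tt) th2th).
apply: (pole_near i sb Tt) => u Tu; apply: le_trans (tb u Tu) _; nra.
Qed.

Lemma pole_height_count s :
  pole_height s = 2 * (\sum_i ~~ s i)%N%:R - p%:R :> R.
Proof.
have -> : p%:R = \sum_(i < p) (1 : R) by rewrite sumr_const card_ord.
rewrite natr_sum mulr_sumr -sumrB.
by apply: eq_bigr => i _; case: (s i); rewrite ?expr0 ?expr1 /=; lra.
Qed.

(** Induction on the number of north poles in the limit configuration, which [descend] lowers. *)
Lemma reach_south X r : spheres X -> 0 < r ->
  exists b s, [/\ solution e b, dist2 X (b 0) < r, settles b s & forall i, s i].
Proof.
move=> SX; have [a sa <-] := extend 0 SX; have [s sas] := solution_settles e_inj sa.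
have [n] := ubnP (\sum_i ~~ s i)%N.
elim: n a s r sa sas {X SX} => // n IHn a s r sa sas sn r0.
have [/forallP sT|/forallPn[j sj]] := boolP [forall i, s i].
  by exists a, s; split; rewrite ?dist2xx.
(* Squared distances obey the triangle inequality up to a factor 2: two steps of [r / 5] cost at
   most [4 * r / 5 < r]. *)
have r4 : 0 < r / 5 by rewrite divr_gt0.
have [b [s' [sb ab sbs']]] := descend sa sas sj r4.
rewrite !pole_height_count => ss'.
have s'n : (\sum_i ~~ s' i < n)%N.
  have : (\sum_i ~~ s' i < \sum_i ~~ s i)%N by rewrite -(ltr_nat R); lra.
  by move=> h; exact: leq_trans h sn.
have [c [s'' [sc bc scs sT]]] := IHn _ _ _ sb sbs' s'n r4.
exists c, s''; split=> //.
have : dist2 (a 0) (c 0) <= 2 * dist2 (a 0) (b 0) + 2 * dist2 (b 0) (c 0); last by lra.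
rewrite /dist2 !mulr_sumr -big_split; apply: ler_sum => i _ /=.
have sq (u v w : R) : (u - w) ^+ 2 <= 2 * (u - v) ^+ 2 + 2 * (v - w) ^+ 2.
  by have := sqr_ge0 (u - v - (v - w)); lra.
have := sq (xc (a 0) i) (xc (b 0) i) (xc (c 0) i).
have := sq (yc (a 0) i) (yc (b 0) i) (yc (c 0) i).
have := sq (zc (a 0) i) (zc (b 0) i) (zc (c 0) i).
by lra.
Qed.

(** The value [2 - p%:R] is the height of a configuration with a single north pole, the lowest above
    the south one. *)
Lemma low_settles_south a s t : solution e a -> settles a s ->
  height (a t) < 2 - p%:R -> forall i, s i.
Proof.
move=> sa sas ht i; apply/negPn/negP => si.
have := height_ge_limit t sa sas; rewrite pole_height_count => h.
have : (1 <= \sum_k ~~ s k)%N by rewrite (bigD1 i) //= si.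
by rewrite -(ler_nat R); lra.
Qed.

End Descent.

(** * Topology of the basin *)

Section Basin.
Context {R : realType} {p : nat}.
Implicit Types (X Y : 'M[R]_(p, 3)) (U : set 'M[R]_(p, 3)) (e : 'I_p -> R).

Lemma nbhs_dist2 X r : 0 < r -> nbhs X [set Y | dist2 X Y < r].
Proof.
move=> r0; have P0 : 0 < 3 * p%:R + 1 :> R by rewrite ltr_wpDl // mulr_ge0.
apply/nbhs_ballP; set d := Num.min 1 (r / (3 * p%:R + 1)).
have d0 : 0 < d by rewrite lt_min ltr01 divr_gt0.
exists d => //= Y [_ XY].
have dr : d * (3 * p%:R + 1) <= r by rewrite -ler_pdivlMr // ge_min lexx orbT.
have d1 : d <= 1 by rewrite ge_min lexx.
apply: lt_le_trans dr; apply: (@le_lt_trans _ _ (p%:R * (3 * d))); last by lra.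
apply: le_trans (ler_norm _) _; apply: norm_sum_le => i.
have sq k : (X i k - Y i k) ^+ 2 <= d.
  have := XY i k; rewrite /ball /= => /ltW h.
  rewrite -real_normK ?num_real // expr2.
  by have := normr_ge0 (X i k - Y i k); nra.
rewrite ger0_norm ?addr_ge0 ?sqr_ge0 //.
by have := sq 0; have := sq 1; have := sq 2; rewrite /xc /yc /zc; lra.
Qed.

Lemma dist2_nbhs X U : nbhs X U -> exists2 r, 0 < r & forall Y, dist2 X Y < r -> U Y.
Proof.
move=> /nbhs_ballP[d /= d0 dU]; exists (d ^+ 2); first by rewrite exprn_gt0.
move=> Y XY; apply: dU; split=> // i k; rewrite /ball /=.
have lt (u : R) : u ^+ 2 <= dist2 X Y -> `|u| < d.
  move=> h; rewrite -(ltr_pXn2r (n := 2)) ?nnegrE ?(ltW d0) //.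
  by rewrite real_normK ?num_real // (le_lt_trans h).
have [/lt hx /lt hy /lt hz] := dist2_coord X Y i.
by case: k => [[|[|[|//]]]] hk; [move: hx|move: hy|move: hz];
  rewrite /xc /yc /zc; congr (`|X i _ - Y i _| < d); apply: val_inj.
Qed.

Lemma south_coord i :
  [/\ xc (south R p) i = 0, yc (south R p) i = 0 & zc (south R p) i = -1].
Proof. by rewrite /xc /yc /zc /south !mxE. Qed.

Lemma spheres_south : spheres (south R p).
Proof. by move=> i; have [-> -> ->] := south_coord i; ring. Qed.

(** Thus [height] measures the distance to the south point, and its decrease alone gives Lyapunov
    stability. *)
Lemma dist2_south X : spheres X -> dist2 (south R p) X = 2 * (height X + p%:R).
Proof.
move=> SX; have -> : p%:R = \sum_(i < p) (1 : R) by rewrite sumr_const card_ord.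
rewrite /height -big_split mulr_sumr; apply: eq_bigr => i _ /=.
have [-> -> ->] := south_coord i; have := SX i; lra.
Qed.

Lemma settles_south e a s : solution e a -> settles a s -> (forall i, s i) ->
  a t @[t --> +oo%R] --> south R p.
Proof.
move=> sa sas sT U /dist2_nbhs[r r0 rU].
have [|T hT] := @settles_height _ _ a s sas (r / 4); first by lra.
exists T; split=> [|t /ltW/hT]; first exact: num_real.
have -> : pole_height s = - p%:R :> R.
  by rewrite pole_height_count big1 => [|i _]; rewrite ?sT //; ring.
rewrite opprK ler_norml => /andP[_ h]; apply: rU.
by rewrite dist2_south; [lra|exact: sa.1].
Qed.

End Basin.

Theorem theorem1 (R : realType) (p : nat) (e : 'I_p -> R)
    (phi : R -> 'M[R]_(p, 3) -> 'M[R]_(p, 3)) :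
  (1 <= p)%N -> injective e ->
  is_flow_on (@spheres R p) (closed_loop e) phi ->
  let B := basin (@spheres R p) phi (south R p) in
  [/\ spheres (south R p),
      asymptotically_stable (@spheres R p) phi (south R p),
      open (B : set (subspace (@spheres R p))) &
      @spheres R p `<=` closure B].
Proof.
move=> _ e_inj flow B.
have sol X : spheres X -> solution e (phi ^~ X).
  by move=> /flow[].
have phi0 X : spheres X -> phi 0 X = X by move=> /flow[].
have extend (T : R) X : spheres X -> exists2 a, solution e a & a T = X.
  move=> SX; exists (fun t => phi (t - T) X); first exact: solution_shift (sol _ SX).
  by rewrite subrr phi0.
have low X T : spheres X -> height (phi T X) < 2 - p%:R -> B X.
  move=> SX hT; split=> //; have [s sas] := solution_settles e_inj (sol _ SX).
  exact: settles_south (sol _ SX) sas (low_settles_south (sol _ SX) sas hT).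
(* By [dist2_south], squared distance below 4 means height below [2 - p%:R]. *)
have B_low X : B X -> exists T, height (phi T X) < 2 - p%:R.
  move=> [SX cX]; have [|T [_ hT]] := cX [set Y | dist2 (south R p) Y < 4].
    by apply: nbhs_dist2; lra.
  exists (T + 1); have /= := hT (T + 1); rewrite ltrDl ltr01 => /(_ isT).
  by rewrite dist2_south; [lra|exact: (sol _ SX).1].
have B_near X : B X -> within (@spheres R p) (nbhs X) B.
  move=> BX; have [T hT] := B_low X BX; have [SX _] := BX.
  have p1 : 0 < p%:R + 1 :> R by rewrite ltr_wpDl.
  (* A move of size [d] at time [T] changes the height by at most [p%:R * d], less than the
     available margin. *)
  set d := (2 - p%:R - height (phi T X)) / (p%:R + 1).
  have d0 : 0 < d by rewrite divr_gt0 //; lra.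
  set E := expR (8 * p%:R ^+ 2 * `|T - 0|); have E0 : 0 < E by exact: expR_gt0.
  have r0 : 0 < d ^+ 2 / E by rewrite divr_gt0 // exprn_gt0.
  apply: filterS (nbhs_dist2 X r0) => Y /= XY SY; apply: (low Y T SY).
  have XYT : dist2 (phi T X) (phi T Y) <= d ^+ 2.
    apply: le_trans (dist2_solutions 0 T (sol _ SX) (sol _ SY)) _.
    by rewrite !phi0 // -/E -ler_pdivlMr // ltW.
  apply: le_lt_trans (height_lipschitz (ltW d0) XYT) _.
  have : (p%:R + 1) * d = 2 - p%:R - height (phi T X).
    by rewrite mulrC divfK // gt_eqF.
  by lra.
have S0 := @spheres_south R p.
have B0 : B (south R p).
  apply: (low _ 0 S0); rewrite phi0 //.
  by have := dist2_south S0; rewrite dist2xx; lra.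
split=> //.
- split=> [U /dist2_nbhs[r r0 rU]|]; last exact: B_near.
  apply: filterS (nbhs_dist2 (south R p) r0) => Y /= YS SY t t0.
  apply: rU; apply: le_lt_trans YS.
  rewrite !dist2_south //; last exact: (sol _ SY).1.
  by have := height_nonincreasing (sol _ SY) t0; rewrite phi0 //; lra.
- rewrite openE => X BX; rewrite /interior /nbhs /= -nbhs_subspace_in; first exact: B_near.
  by case: BX.
- move=> X SX U /dist2_nbhs[r r0 rU].
  have [b [s [sb Xb sbs sT]]] := reach_south e_inj extend SX r0.
  exists (b 0); split; last exact: rU.
  split; first exact: sb.1.
  (* The solution built by successive perturbations is the flow line of its initial point, by
     uniqueness. *)
  have -> : phi ^~ (b 0) = b; last exact: settles_south sb sbs sT.
  apply/funext => t; apply: (solution_unique (s := 0) t (sol _ (sb.1 0)) sb).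
  by rewrite phi0 //; exact: sb.1.
Qed.
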